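(* Let $\mathcal D_n$ be the critical beta-splitting random tree with $n$ leaves. For any full binary tree $t$, as $n\to\infty$, $$\mathbb{P}(\mathcal D^*_n=t\mid\mathcal D_n)\overset{\mathrm p}{\longrightarrow}\mathbb{P}(\mathcal D^*_\infty=t),$$ where $\mathbb{P}(\mathcal D^*_\infty=\bullet)=\frac12$ and $\mathbb{P}(\mathcal D^*_\infty=t)=\frac{3}{\pi^2}\frac{h_{m-1}}{m(m-1)}\mathbb{P}(\mathcal D_m=t)$ if $m:=|t|_{\mathsf e}\ge2$. Hence, $$q(\mathcal D_n;t\mid\mathcal D_n)\overset{\mathrm p}{\longrightarrow}q(\mathcal D^{**}_\infty;t),$$ where $q(\mathcal D^{**}_\infty;\bullet)=1$ and $q(\mathcal D^{**}_\infty;t)=\frac{6}{\pi^2}\frac{h_{m-1}}{m-1}\mathbb{P}(\mathcal D_m=t)$ if $m=|t|_{\mathsf e}\ge2$. Furthermore, $$\frac{N_t(\mathcal D_n)}{n}\overset{\mathrm p}{\longrightarrow}q(\mathcal D^{**}_\infty;t).$$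
   Context: Trees. A binary tree is a (finite, non-empty) rooted tree in which each child is labelled left or right and each node has at most one left and at most one right child. It is full if each node has outdegree 0 or 2. $|T|_{\mathsf e}$ is the number of leaves of $T$; $\bullet$ is the tree with one node. For $v\in T$, the fringe tree $T^v$ consists of $v$ and all its descendants, and $N_t(T):=|\{v\in T:T^v=t\}|$ (equality as binary trees). The random fringe tree $T^*$ of a tree $T$ is $T^v$ for a uniformly random node $v$ of $T$ (if $T$ is random, first condition on $T$; $\mathbb{P}(T^*=t\mid T)$ is the conditional probability given $T$). In particular $\mathcal D_n^*$ is the random fringe tree of $\mathcal D_n$. For a random tree $T$, $q(T;t\mid T)$ denotes the conditional probability, given $T$, that a uniformly random leaf of $T$ lies in some fringe tree $T^w$ that is isomorphic to $t$. The symbols $\mathbb{P}(\mathcal D^*_\infty=t)$ and $q(\mathcal D^{**}_\infty;t)$ denote the numbers given by the formulas in the claim; they describe the limiting random fringe tree $\mathcal D^*_\infty$ and the limiting extended fringe tree (of a uniformly random leaf) $\mathcal D^{**}_\infty$. $\overset{\mathrm p}{\longrightarrow}$ denotes convergence in probability, and $h_n:=\sum_{i=1}^n 1/i$. The critical beta-splitting random tree $\mathcal D_n$ is the random full binary tree with $n$ leaves defined recursively: $\mathcal D_1=\bullet$; for $n\ge2$, the left subtree of the root has $i$ leaves (and the right subtree $n-i$ leaves) with probability $\frac{n}{2h_{n-1}}\cdot\frac{1}{i(n-i)}$, $1\le i\le n-1$, and, given this, the left and right subtrees are independent copies of $\mathcal D_i$ and $\mathcal D_{n-i}$.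
   Formalization: The third limit is proved as N_t(D_n)/n → q(D**_∞;t)/|t|_e, since the printed limit without the factor 1/|t|_e fails for |t|_e ≥ 2: for the two-leaf tree it would be 6/π² > 1/2, yet a tree with n leaves has at most n/2 such fringe trees. *)

(* Defs.v *)
From HB Require Import structures.
From mathcomp Require Import all_boot all_order all_algebra.
From mathcomp Require Import all_classical all_reals all_analysis.
Import Order.TTheory GRing.Theory Num.Theory.
Import numFieldNormedType.Exports.
Set Implicit Arguments.
Unset Strict Implicit.
Unset Printing Implicit Defensive.
Local Open Scope classical_set_scope.
Local Open Scope ring_scope.

(* Full binary trees: every node has either no child, or a left and a right
   child.  As these trees are ordered, Leibniz equality is equality as binary
   trees. *)
Inductive fbtree : Type :=
| Leaf
| Node of fbtree & fbtree.

Fixpoint fbtree_encode (T : fbtree) : GenTree.tree unit :=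
  match T with
  | Leaf => GenTree.Node 0 [::]
  | Node l r => GenTree.Node 1 [:: fbtree_encode l; fbtree_encode r]
  end.

Fixpoint fbtree_decode (c : GenTree.tree unit) : option fbtree :=
  match c with
  | GenTree.Node 0 [::] => Some Leaf
  | GenTree.Node 1 [:: cl; cr] =>
      match fbtree_decode cl, fbtree_decode cr with
      | Some l, Some r => Some (Node l r)
      | _, _ => None
      end
  | _ => None
  end.

Lemma fbtree_encodeK : pcancel fbtree_encode fbtree_decode.
Proof. by elim=> //= l -> r ->. Qed.

HB.instance Definition _ := Countable.copy fbtree (pcan_type fbtree_encodeK).
HB.instance Definition _ := isPointed.Build fbtree Leaf.
HB.instance Definition _ := @isMeasurable.Build default_measure_display
  fbtree discrete_measurable discrete_measurable0
  discrete_measurableC discrete_measurableU.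

(* A node is identified with its address, i.e. the path from the root to it
   ([false] is a step to the left, [true] a step to the right); thus [w] is [u]
   or an ancestor of [u] iff [prefix w u]. *)
Fixpoint nodes (T : fbtree) : seq (seq bool) :=
  match T with
  | Leaf => [:: [::]]
  | Node l r =>
      [::] :: [seq false :: v | v <- nodes l] ++ [seq true :: v | v <- nodes r]
  end.

(* The fringe tree T^v; the value is irrelevant when [v \notin nodes T]. *)
Fixpoint fringe (T : fbtree) (v : seq bool) {struct v} : fbtree :=
  match v, T with
  | [::], _ => T
  | b :: v', Node l r => fringe (if b then r else l) v'
  | _ :: _, Leaf => Leaf
  end.

Definition leaves (T : fbtree) : seq (seq bool) :=
  [seq v <- nodes T | fringe T v == Leaf].

Definition nleaves (T : fbtree) : nat := size (leaves T).

Definition fringe_count (t T : fbtree) : nat :=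
  count (fun v => fringe T v == t) (nodes T).

(* The probability that [p] holds for a uniformly random item of [s]; only used
   for duplicate-free [s]. *)
Definition uniform_prob (R : realType) (A : Type) (s : seq A) (p : pred A) : R :=
  (count p s)%:R / (size s)%:R.

(* P(T^* = t), for a deterministic tree T; evaluated at a random tree, this is
   the conditional probability given that tree. *)
Definition fringe_prob (R : realType) (t T : fbtree) : R :=
  uniform_prob R (nodes T) (fun v => fringe T v == t).

(* q(T; t): the probability that a uniformly random leaf [u] of T belongs to
   some fringe tree T^w equal to t.  Distinct fringe trees equal to t are
   disjoint, so q(T; t) = nleaves t * fringe_count t T / nleaves T; this is the
   reason for the factor (nleaves t)^-1 between the limits of q(D_n; t) and of
   fringe_count t D_n / n. *)
Definition leaf_fringe_prob (R : realType) (t T : fbtree) : R :=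
  uniform_prob R (leaves T)
    (fun u => has (fun w => prefix w u && (fringe T w == t)) (nodes T)).

Definition harmonic_number (R : realType) (n : nat) : R :=
  \sum_(1 <= i < n.+1) i%:R^-1.

Definition split_prob (R : realType) (n i : nat) : R :=
  n%:R / (2 * harmonic_number R n.-1) * (1 / (i%:R * (n%:R - i%:R))).

(* P(D_n = T): in the inductive case, condition on the number [i] of leaves of
   the left subtree, the two subtrees being then independent copies of D_i and
   D_(n-i).  The sum is empty if n = 1. *)
Fixpoint critical_beta_prob (R : realType) (n : nat) (T : fbtree) : R :=
  match T with
  | Leaf => (n == 1%N)%:R
  | Node l r =>
      \sum_(1 <= i < n) split_prob R n i *
        (critical_beta_prob R i l * critical_beta_prob R (n - i)%N r)
  end.

Definition is_critical_beta_tree (R : realType) (d : measure_display)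
    (Omega : measurableType d) (P : probability Omega R) (n : nat)
    (D : {RV P >-> fbtree}) : Prop :=
  forall T : fbtree, distribution P D [set T] = (critical_beta_prob R n T)%:E.

Definition fringe_limit (R : realType) (t : fbtree) : R :=
  let m := nleaves t in
  if t == Leaf then 1 / 2
  else 3 / pi ^+ 2 * (harmonic_number R m.-1 / (m%:R * (m%:R - 1)))
       * critical_beta_prob R m t.

Definition extended_fringe_limit (R : realType) (t : fbtree) : R :=
  let m := nleaves t in
  if t == Leaf then 1
  else 6 / pi ^+ 2 * (harmonic_number R m.-1 / (m%:R - 1))
       * critical_beta_prob R m t.

(* Convergence in probability to a constant; the variables may live on
   different probability spaces. *)
Definition cvg_in_probability (R : realType) (d : nat -> measure_display)
    (Omega : forall n, measurableType (d n))
    (P : forall n, probability (Omega n) R)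
    (X : forall n, Omega n -> R) (c : R) : Prop :=
  forall eps : R, 0 < eps ->
    (fun n => P n [set w | eps < `|X n w - c|]) @ \oo --> 0%E.

(* Main.v *)
Require Import Defs.
From mathcomp Require Import all_boot all_order all_algebra.
From mathcomp Require Import all_classical all_reals all_analysis.
From mathcomp Require Import ring lra zify.
Import Order.TTheory GRing.Theory Num.Theory.
Import numFieldNormedType.Exports.
Set Implicit Arguments.
Unset Strict Implicit.
Unset Printing Implicit Defensive.
Local Open Scope classical_set_scope.
Local Open Scope ring_scope.

(* Second moment method for X_n = N_t(D_n).  Write h for the harmonic numbers
   and put u_p = E X_{p+1} / (p+1), shifting indices by one.  For p >= |t|_e
   splitting at the root gives h_p u_p = sum_{q<p} u_q / (p-q), and then
   W_p = sum_{1<=q<=p} u_q (h_p - h_{p-q}) / q does not depend on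
   p >= |t|_e - 1; the weights in W_p have total mass S_p = sum_{k<=p} 1/k^2.
   Convergence of u comes from a maximum principle: let n maximise
   u_q + e h_q over q <= N.  Then u_N <= u_n, n tends to infinity with N, and
   since sum_{q<n} (h_n - h_q) / (n-q) is again S_n, the values u_q with q <= n
   are so close to u_n on average that u_n S_n <= W + e S_n.  The same for -u
   gives u -> W / (pi^2/6).  The normalised mean squares of the additive
   functional X_n - b n, b = lim u, satisfy a similar recursion, whose kernel
   loses mass and whose source tends to 0, and the same maximum principle shows
   that they tend to 0.  Both other ratios in the theorem are deterministic
   multiples of X_n / n. *)

(** * Averages with harmonic weights *)

Section Harmonic.
Variable R : realType.
Implicit Types (u z : nat -> R) (n p q k N : nat).
Local Notation h := (harmonic_number R).

Lemma harmonic_number0 : h 0 = 0.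
Proof. by rewrite /harmonic_number big_nil. Qed.

Lemma harmonic_numberS n : h n.+1 = h n + n.+1%:R^-1.
Proof. by rewrite /harmonic_number big_nat_recr. Qed.

Lemma harmonic_numberE n : h n = \sum_(q < n) q.+1%:R^-1.
Proof.
elim: n => [|n IH]; first by rewrite harmonic_number0 big_ord0.
by rewrite big_ord_recr -IH harmonic_numberS.
Qed.

Lemma le_harmonic_number n p : (n <= p)%N -> h n <= h p.
Proof.
move=> /subnKC <-; elim: (p - n)%N => [|k IH]; first by rewrite addn0.
by rewrite addnS harmonic_numberS (le_trans IH) // lerDl invr_ge0.
Qed.

Lemma harmonic_number_gt0 n : (0 < n)%N -> 0 < h n.
Proof.
move=> n0; apply: lt_le_trans (le_harmonic_number n0).
by rewrite harmonic_numberS harmonic_number0 add0r invr_gt0 ltr0n.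
Qed.

Lemma harmonic_number_ge (A : R) : \forall n \near \oo, A <= h n.
Proof.
have Eh : series (@harmonic R) = h.
  by apply/funext => n; rewrite /series /= big_mkord harmonic_numberE.
have nd : {homo h : n p / (n <= p)%N >-> n <= p}.
  by move=> n p /le_harmonic_number.
have /cvgryPge := nondecreasing_dvgn_lt nd (ltac:(rewrite -Eh; exact: dvg_harmonic)).
exact.
Qed.

Lemma harmonic_number_rev p : \sum_(q < p) (p - q)%:R^-1 = h p.
Proof.
rewrite harmonic_numberE (reindex_inj rev_ord_inj) /=.
by apply: eq_bigr => q _; congr (_%:R^-1); have := ltn_ord q; lia.
Qed.

Lemma harmonic_numberB a i : h (a + i) - h a <= i%:R / a.+1%:R.
Proof.
elim: i => [|i IH]; first by rewrite addn0 subrr mul0r.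
rewrite addnS harmonic_numberS addrAC -[i.+1]addn1 natrD mulrDl mul1r lerD //.
by rewrite lef_pV2 ?posrE ?ltr0n // ler_nat; lia.
Qed.

Definition inv_squares_sum p : R := \sum_(k < p) (k.+1%:R ^+ 2)^-1.
Local Notation S := inv_squares_sum.

(** This is the quantity W_p of the overview. The weights are indexed from [q.+1], so that [u 0]
    does not enter. *)
Definition smoothing p u : R :=
  \sum_(q < p) u q.+1 * ((h p - h (p - q.+1)) / q.+1%:R).

(** Termwise, the weight of [u q.+1] changes by (1/(p+1) - 1/(p-q))/(q+1) = -1/((p+1)(p-q)). So
    [smoothing] stays constant wherever [u 0 = 0] and the harmonic recursion holds at [p.+1]. *)
Lemma smoothingS p u :
  smoothing p.+1 u - smoothing p u =
  p.+1%:R^-1 * (h p.+1 * u p.+1 - \sum_(q < p) u q.+1 / (p - q)%:R).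
Proof.
rewrite /smoothing big_ord_recr /= subnn harmonic_number0 subr0.
rewrite addrAC -sumrB mulrBr addrC; congr (_ + _); first by ring.
rewrite mulr_sumr -sumrN; apply: eq_bigr => -[/= q qp] _.
have [r Er] : exists r, p = (q + r).+1 by exists (p - q.+1)%N; lia.
have -> : (p.+1 - q.+1 = r.+1)%N by lia.
have -> : (p - q.+1 = r)%N by lia.
have -> : (p - q = r.+1)%N by lia.
rewrite !harmonic_numberS; move: (h p) (h r) (u q.+1) => x y v.
rewrite {p qp}Er -[(q + r).+2]addn2 -[q.+1]addn1 -[r.+1]addn1 !natrD.
have Hq : (q%:R : R) >= 0 by [].
have Hr : (r%:R : R) >= 0 by [].
by field; apply/and3P; split; lra.
Qed.

(** For the constant sequence the increment is (h_{p+1} - h_p)/(p+1) = 1/(p+1)^2. *)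
Lemma smoothing1 p : smoothing p (fun=> 1) = S p.
Proof.
elim: p => [|p IH]; first by rewrite /smoothing /S !big_ord0.
have /eqP := smoothingS p (fun=> 1); rewrite subr_eq => /eqP ->.
rewrite IH /S big_ord_recr /= addrC; congr (_ + _).
under eq_bigr do rewrite mul1r.
rewrite harmonic_number_rev harmonic_numberS mulr1 addrAC subrr add0r.
by rewrite -invfM -expr2.
Qed.

Lemma harmonic_number_smoothing p :
  \sum_(q < p) (h p - h q) / (p - q)%:R = S p.
Proof.
rewrite -smoothing1 /smoothing (reindex_inj rev_ord_inj) /=.
apply: eq_bigr => q _; rewrite mul1r; do 3 f_equal.
by have := ltn_ord q; lia.
Qed.

Lemma inv_squares_sum_ge0 p : 0 <= S p.
Proof. by apply: sumr_ge0 => k _; rewrite invr_ge0 exprn_ge0. Qed.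

Lemma le_inv_squares_sum p q : (p <= q)%N -> S p <= S q.
Proof.
move=> /subnKC <-; elim: (q - p)%N => [|k IH]; first by rewrite addn0.
by rewrite addnS (le_trans IH) // /S big_ord_recr /= lerDl invr_ge0 exprn_ge0.
Qed.

(* Tilting by the slowly increasing [e * h] forces the maximiser to infinity
   while keeping its value above [u N]. *)
Lemma exists_tilted_max u (B e : R) k : (forall n, `|u n| <= B) -> 0 < e ->
  \forall N \near \oo, exists n, [/\ (k <= n)%N, u N <= u n &
    forall q, (q < n)%N -> u q + e * h q <= u n + e * h n].
Proof.
move=> uB e0; near=> N.
(* With h_N this large no maximiser lies below [k]: maximality gives e (h_N - h_n) <= u_n - u_N <=
   2B, whereas n < k would make the left side exceed 2B. *)
have hN : 2 * B / e + h k + 1 <= h N by near: N; exact: harmonic_number_ge.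
have kN : (k <= N)%N by near: N; exact: nbhs_infty_ge.
pose f q := u q + e * h q.
case: (@arg_maxP _ _ _ (@ord0 N) predT (fun i : 'I_N.+1 => f i) isT) => n _ nmax.
have {}nmax q : (q <= N)%N -> f q <= f n.
  by move=> qN; have := nmax (Ordinal (qN : (q < N.+1)%N)) isT.
have nN : (n <= N)%N by rewrite -ltnS.
have := nmax N (leqnn N); rewrite /f => fN.
exists n; split.
- rewrite leqNgt; apply/negP => nk.
  have hnk := le_harmonic_number (ltnW nk).
  have : e * (h N - h n) <= 2 * B.
    by have := uB N; have := uB n; rewrite !ler_norml => /andP[? ?] /andP[? ?]; lra.
  rewrite mulrC -ler_pdivlMr // => ?; lra.
- have : e * h n <= e * h N by rewrite ler_pM2l // le_harmonic_number.
  by lra.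
- by move=> q qn; apply: nmax; lia.
Unshelve. all: by end_near. Qed.

(** The tilted differences split into the defect of the harmonic recursion at [n] and the
    contribution [e * S n] of the tilt. At a tilted maximum all summands are nonnegative, so this
    identity bounds how far the earlier values fall below [u n]. *)
Lemma tilted_sum u e n : \sum_(q < n) ((u n + e * h n) - (u q + e * h q)) / (n - q)%:R
  = h n * u n - \sum_(q < n) u q / (n - q)%:R + e * S n.
Proof.
have -> : h n * u n = \sum_(q < n) u n / (n - q)%:R.
  by rewrite -mulr_sumr harmonic_number_rev mulrC.
rewrite -harmonic_number_smoothing [e * \sum_(q < n) _]mulr_sumr -sumrB -big_split /=.
by apply: eq_bigr => q _; ring.
Qed.

(** At a tilted maximum n the recursion makes the tilted sum equal to e S_n. The weights of
    [smoothing] are dominated by the kernel of that sum, so u_n S_n - C <= e S_n. The lower bound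
    [k] on n later allows S_n to be replaced by its limit. *)
Lemma harmonic_average_upper u (B C e : R) mu k :
    (forall n, `|u n| <= B) -> 0 < e ->
    (forall p, (mu < p)%N -> h p * u p = \sum_(q < p) u q / (p - q)%:R) ->
    (forall p, (mu <= p)%N -> smoothing p u = C) ->
  \forall N \near \oo, exists2 n, (k <= n)%N & u N * S n <= C + e * S n.
Proof.
move=> uB e0 uH uC; have := exists_tilted_max (maxn k mu.+1) uB e0.
apply: filterS => N [n [kn uN nmax]]; exists n; first by lia.
apply: le_trans (_ : u n * S n <= _).
  by rewrite ler_wpM2r ?inv_squares_sum_ge0.
have := tilted_sum u e n; rewrite uH ?subrr ?add0r; last by lia.
move=> <-; rewrite -lerBlDl -(uC n) -?smoothing1; last by lia.
have n0 : (0 < n)%N by lia.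
case: n n0 kn uN nmax => // n _ kn uN nmax.
(* On the left the last summand is u_n - u_n = 0; on the right the summand of index 0 is nonnegative
   and is dropped. The remaining summands are compared one by one at index [q.+1]. *)
rewrite /smoothing mulr_sumr -sumrB big_ord_recr /= mul1r subrr addr0 [leRHS]big_ord_recl.
rewrite -[leLHS]add0r lerD //.
  by rewrite divr_ge0 // subr_ge0 nmax.
apply: ler_sum => q _ /=.
have qn : (q < n)%N := ltn_ord q.
have fq := nmax q.+1 qn.
have hq : h q.+1 <= h n.+1 by apply: le_harmonic_number; lia.
have Ha := @harmonic_numberB (n.+1 - q.+1) q.+1.
have Hm : h (n.+1 - q.+1) <= h n.+1 by apply: le_harmonic_number; lia.
have En : (n.+1 - q.+1 + q.+1 = n.+1)%N by lia.
rewrite En in Ha.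
rewrite mul1r -mulrBl.
have ehq : e * h q.+1 <= e * h n.+1 by rewrite ler_pM2l.
(* First the tilt is added, which only increases the difference; then the weight, at most 1/(n-q+1),
   is enlarged to 1/(n-q), which is allowed as the tilted difference is nonnegative. *)
apply: le_trans (_ : (u n.+1 + e * h n.+1 - (u q.+1 + e * h q.+1)) *
   ((h n.+1 - h (n.+1 - q.+1)) / q.+1%:R) <= _).
  apply: ler_wpM2r; last by lra.
  by rewrite divr_ge0 // subr_ge0.
rewrite ler_wpM2l ?subr_ge0 //.
rewrite ler_pdivrMr ?ltr0n // (le_trans Ha) // mulrC ler_wpM2r //.
by rewrite /bump add1n lef_pV2 ?posrE ?ltr0n ?ler_nat; lia.
Qed.

(* The size-biased kernel has total mass [h p - p / p.+1]: this loss of mass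
   beats the vanishing source [d]. *)
Lemma damped_average_cvg0 z (d : nat -> R) (B : R) mu :
    (forall p, 0 <= z p <= B) -> d @ \oo --> 0 -> (forall p, S p <= B) ->
    (forall p, (mu < p)%N -> h p * z p =
       \sum_(q < p) z q * (q.+1%:R / (p.+1%:R * (p - q)%:R)) + d p) ->
  z @ \oo --> 0.
Proof.
move=> zB d0 SB zH; apply/cvgrPdist_le => /= e e0.
have B0 : 0 <= B by have /andP[] := zB 0; apply: le_trans.
(* Small enough that the tilt contributes e1 S_n <= e/4, because S_n <= B. *)
pose e1 := e / (4 * (B + 1)).
have e10 : 0 < e1 by rewrite divr_gt0 //; lra.
have uB n : `|z n| <= B by have /andP[z0 zb] := zB n; rewrite ger0_norm.
have [k _ kd] : \forall n \near \oo, `|d n| <= e / 4.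
  by move/cvgr0Pnorm_le: d0; apply; rewrite divr_gt0.
have := exists_tilted_max (maxn k mu.+1) uB e10.
apply: filterS => N [n [kn uN nmax]].
have /andP[zN0 _] := zB N.
rewrite sub0r normrN ger0_norm // (le_trans uN) //.
have := tilted_sum z e1 n.
rewrite zH; last by lia.
(* Partial fractions: (q+1)/((n+1)(n-q)) = 1/(n-q) - 1/(n+1). The second part is the lost mass. *)
have -> : \sum_(q < n) z q * (q.+1%:R / (n.+1%:R * (n - q)%:R)) =
   \sum_(q < n) z q / (n - q)%:R - \sum_(q < n) z q / n.+1%:R.
  rewrite -sumrB; apply: eq_bigr => -[/= q qn] _.
  have [r ->] : exists r, n = (q + r).+1 by exists (n - q.+1)%N; lia.
  have -> : ((q + r).+1 - q = r.+1)%N by lia.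
  rewrite -[(q + r).+2]addn2 -[q.+1]addn1 -[r.+1]addn1 !natrD.
  move: (z q) => v.
  have Hq : (q%:R : R) >= 0 by [].
  have Hr : (r%:R : R) >= 0 by [].
  by field; apply/andP; split; lra.
have dn : `|d n| <= e / 4 by apply: kd => /=; lia.
have e1S : e1 * S n <= e / 4.
  apply: le_trans (_ : e1 * (B + 1) <= _).
    by rewrite ler_pM2l //; have := SB n; lra.
  have -> : e1 * (B + 1) = e / 4 by rewrite /e1; field; lra.
  exact: lexx.
have H : \sum_(q < n) (z n - z q) / n.+1%:R <=
  \sum_(q < n) (z n + e1 * h n - (z q + e1 * h q)) / (n - q)%:R.
  apply: ler_sum => q _.
  have qn := ltn_ord q.
  have := nmax q qn.
  have : e1 * h q <= e1 * h n by rewrite ler_pM2l // le_harmonic_number // ltnW.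
  move=> hq fq.
  apply: le_trans (_ : (z n + e1 * h n - (z q + e1 * h q)) / n.+1%:R <= _).
    by rewrite ler_wpM2r ?invr_ge0 //; lra.
  have nq0 : (0 < n - q)%N by lia.
  have nqn : (n - q <= n.+1)%N by lia.
  by rewrite ler_wpM2l ?subr_ge0 // lef_pV2 ?posrE ?ltr0n // ler_nat.
move: H; rewrite -mulr_suml sumrB sumr_const card_ord mulrBl.
rewrite -[\sum_(q < n) z q / n.+1%:R]mulr_suml => H E.
(* The sums of z_q/(n+1) cancel between [H] and [E], leaving z_n n/(n+1) <= d_n + e1 S_n. Since n >=
   1, the factor n/(n+1) is at least 1/2. *)
have : z n *+ n / n.+1%:R <= e / 2.
  move: dn; rewrite ler_norml => /andP[_ dn].
  have key (A Z X s dt : R) : A - Z <= X - Z + dt - X + s ->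
    s <= e / 4 -> dt <= e / 4 -> A <= e / 2 by lra.
  by rewrite E in H; exact: key H e1S dn.
have : z n / 2 <= z n *+ n / n.+1%:R.
  rewrite -[z n *+ n]mulr_natr -mulrA; have /andP[zn0 _] := zB n.
  apply: ler_wpM2l => //; rewrite ler_pdivlMr ?ltr0n // mulrC ler_pdivrMr //.
  by rewrite -natrM ler_nat; lia.
move=> H1 H2; have := le_trans H1 H2; lra.
Qed.

End Harmonic.

(** * The Basel sum and convergence of harmonic averages *)

Section Basel.
Variable R : realType.
Implicit Types (x : R) (n k N : nat).
Local Notation S := (inv_squares_sum R).

Lemma sin_le_id x : 0 <= x -> sin x <= x.
Proof.
move=> x0.
have [c _] := @MVT_segment R sin cos 0 x x0 (fun y _ => is_derive_sin y)
   (continuous_subspaceT (@continuous_sin R)).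
by rewrite sin0 !subr0 => ->; rewrite ler_piMl // cos_le1.
Qed.

Lemma id_le_tan x : 0 <= x < pi / 2 -> x <= tan x.
Proof.
move=> /andP[x0 xpi].
have cos0 y : y \in `[0, x] -> 0 < cos y.
  rewrite in_itv /= => /andP[y0 yx].
  by apply: cos_gt0_pihalf; apply/andP; split; have := @pi_gt0 R; lra.
have [|||c cx] := @MVT_segment R tan (fun y => (cos y) ^-2) 0 x.
- by [].
- move=> y yx; apply: is_derive_tan; rewrite gt_eqF // cos0 //.
  exact: subset_itv_oo_cc.
- apply/continuous_in_subspaceT => y /set_mem /= yx.
  by apply: continuous_tan; rewrite gt_eqF // cos0.
rewrite tan0 !subr0 => ->; rewrite ler_peMl // -exprVn exprn_ege1 //.
by rewrite invf_ge1 ?cos0 // cos_le1.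
Qed.

(** Follows from sin x <= x <= tan x and 1/sin^2 = 1/tan^2 + 1. *)
Lemma inv_sin2_bounds x : 0 < x < pi / 2 ->
  (x ^+ 2)^-1 <= (sin x ^+ 2)^-1 <= (x ^+ 2)^-1 + 1.
Proof.
move=> /andP[x0 xpi].
have s0 : 0 < sin x by apply: sin_gt0_pihalf; rewrite x0.
have c0 : 0 < cos x.
  by apply: cos_gt0_pihalf; apply/andP; split; have := @pi_gt0 R; lra.
have sx := sin_le_id (ltW x0).
have xt : x <= tan x by apply: id_le_tan; rewrite ltW.
apply/andP; split.
  by rewrite lef_pV2 ?posrE ?exprn_gt0 // ler_sqr // nnegrE ltW.
have -> : (sin x ^+ 2)^-1 = (tan x ^+ 2)^-1 + 1.
  have := cos2Dsin2 x; rewrite /tan => E.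
  have -> : 1 = (cos x ^+ 2 + sin x ^+ 2) / sin x ^+ 2 - cos x ^+ 2 / sin x ^+ 2 :> R.
    by field; rewrite gt_eqF.
  by rewrite E; field; rewrite !gt_eqF.
have t0 : 0 < tan x by apply: lt_le_trans xt.
by rewrite lerD2r lef_pV2 ?posrE ?exprn_gt0 // ler_sqr // nnegrE ltW.
Qed.

(** Sum of squared cosecants for the elementary evaluation of the Basel sum: replacing each sine by
    its angle gives 4N^2/pi^2 times a partial sum of 1/k^2. *)
Definition csc2_sum N : R :=
  \sum_(1 <= k < N) (sin (k%:R * pi / (2 * N%:R)) ^+ 2)^-1.

(** The terms k and 2N-k have complementary angles x and pi/2 - x, and 1/sin^2 x + 1/cos^2 x =
    4/sin^2(2x), where 2x is the k-th angle for N. The middle term k = N has angle pi/4 and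
    contributes 2. *)
Lemma csc2_sum_double N : (0 < N)%N ->
  csc2_sum (N + N) = 4 * csc2_sum N + 2.
Proof.
move=> N0; have NR : 0 < N%:R :> R by rewrite ltr0n.
rewrite /csc2_sum (@big_cat_nat _ _ _ N) //=; last by lia.
rewrite (@big_ltn _ _ _ N); last by lia.
rewrite addrCA [RHS]addrC; congr (_ + _).
  have -> : N%:R * pi / (2 * (N + N)%:R) = pi / 4 :> R.
    by rewrite natrD; field; lra.
  have pi4 : pi / 4 + pi / 4 = pi / 2 :> R by field.
  have cs : cos (pi / 4) = sin (pi / 4) :> R.
    have := @tan_piquarter R; rewrite /tan => /divr1_eq //.
  have := cos2Dsin2 (pi / 4 : R); rewrite cs => E.
  have -> : sin (pi / 4 : R) ^+ 2 = 2^-1 by lra.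
  by rewrite invrK.
rewrite -[N.+1]add1n [X in _ + X]big_addn addnK.
rewrite [X in _ + X]big_nat_rev /= -big_split /= mulr_sumr.
rewrite !big_nat; apply: eq_bigr => k /andP[k1 kN].
have -> : (1 + N - k.+1 + N = N + N - k)%N by lia.
rewrite natrB; last by lia.
rewrite !natrD.
set x := k%:R * pi / (2 * (N%:R + N%:R)).
have -> : (N%:R + N%:R - k%:R) * pi / (2 * (N%:R + N%:R)) = - (x - pi / 2) :> R.
  by rewrite /x; field; lra.
have -> : k%:R * pi / (2 * N%:R) = x *+ 2 :> R.
  by rewrite /x; field; lra.
rewrite sinN sinBpihalf opprK sin_mulr2n.
have xpi : 0 < x < pi / 2.
  have pi0 := @pi_gt0 R.
  have N4 : 0 < 2 * (N%:R + N%:R) :> R by lra.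
  rewrite /x; apply/andP; split.
    by apply: divr_gt0 => //; apply: mulr_gt0 => //; rewrite ltr0n.
  rewrite ltr_pdivrMr //.
  have -> : pi / 2 * (2 * (N%:R + N%:R)) = (N + N)%:R * pi :> R.
    by rewrite natrD; field.
  by rewrite ltr_pM2r // ltr_nat; lia.
have s0 : 0 < sin x by apply: sin_gt0_pihalf.
have c0 : 0 < cos x.
  by apply: cos_gt0_pihalf; apply/andP; split; have := @pi_gt0 R; lra.
have := cos2Dsin2 x => E.
have -> : (sin x ^+ 2)^-1 + (cos x ^+ 2)^-1 =
  (cos x ^+ 2 + sin x ^+ 2) / (sin x ^+ 2 * cos x ^+ 2).
  by field; rewrite !gt_eqF.
by rewrite E; field; rewrite !gt_eqF.
Qed.

Lemma csc2_sum_exp2 n : csc2_sum (2 ^ n) = 2 / 3 * (4 ^+ n - 1).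
Proof.
elim: n => [|n IH]; first by rewrite /csc2_sum expn0 big_geq // expr0 subrr mulr0.
by rewrite expnS mul2n -addnn csc2_sum_double ?expn_gt0 // IH exprS; lra.
Qed.

Lemma csc2_sum_bounds N : (0 < N)%N ->
  S N.-1 * (4 * N%:R ^+ 2 / pi ^+ 2) <= csc2_sum N <=
  S N.-1 * (4 * N%:R ^+ 2 / pi ^+ 2) + N%:R.
Proof.
case: N => // N _ /=.
have pi0 := @pi_gt0 R.
have NR : 0 < N.+1%:R :> R by [].
have kE (k : 'I_N) : (k.+1%:R ^+ 2)^-1 * (4 * N.+1%:R ^+ 2 / pi ^+ 2) =
    ((k.+1%:R * pi / (2 * N.+1%:R)) ^+ 2)^-1 :> R.
  have k0 : 0 < k.+1%:R :> R by [].
  move: (k.+1%:R : R) (N.+1%:R : R) pi k0 NR pi0 => a b c a0 b0 c0.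
  by field; rewrite !gt_eqF.
have kb (k : 'I_N) : 0 < (k.+1%:R * pi / (2 * N.+1%:R) : R) < pi / 2.
  have N2 : 0 < 2 * N.+1%:R :> R by rewrite mulr_gt0.
  apply/andP; split; first by apply: divr_gt0 => //; apply: mulr_gt0.
  rewrite ltr_pdivrMr //.
  have -> : pi / 2 * (2 * N.+1%:R) = N.+1%:R * pi :> R by field.
  by rewrite ltr_pM2r // ltr_nat ltnS.
rewrite /csc2_sum big_add1 /= big_mkord /S mulr_suml; apply/andP; split.
  by apply: ler_sum => k _; rewrite kE; have /andP[] := inv_sin2_bounds (kb k).
apply: (@le_trans _ _ (\sum_(k < N)
  (((k.+1%:R ^+ 2)^-1 * (4 * N.+1%:R ^+ 2 / pi ^+ 2)) + 1))).
  by apply: ler_sum => k _; rewrite kE; have /andP[] := inv_sin2_bounds (kb k).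
by rewrite big_split /= lerD2l sumr_const card_ord ler_nat.
Qed.

(** The exact value of [csc2_sum] at 2^n is divided by 4^{n+1}/pi^2. The resulting errors, pi^2/6
    times 4^-n and pi^2/4 times 2^-n, are absorbed into a single multiple of 2^-n. *)
Lemma inv_squares_sum_bounds n :
  pi ^+ 2 / 6 - pi ^+ 2 / 6 * (4 / 2 ^+ n) <= S (2 ^ n).-1 <= pi ^+ 2 / 6.
Proof.
have := csc2_sum_bounds (expn_gt0 2 n); rewrite csc2_sum_exp2 natrX.
have -> : 4 ^+ n = (2 ^+ n) ^+ 2 :> R.
  by rewrite -exprM mulnC exprM; congr (_ ^+ _); ring.
have : 1 <= 2 ^+ n :> R by rewrite exprn_ege1 //; lra.
move: (2 ^+ n : R) => x x1.
have pi0 : 0 < pi ^+ 2 :> R by rewrite exprn_gt0 // pi_gt0.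
have x0 : 0 < x by lra.
set s := S _; set P := pi ^+ 2 => /andP[H1 H2].
have E : s * (4 * x ^+ 2 / P) * (P / (4 * x ^+ 2)) = s.
  by field; rewrite !gt_eqF.
have y0 : 0 < P / (4 * x ^+ 2) by rewrite divr_gt0 // mulr_gt0 // exprn_gt0.
move: H1 H2; rewrite -(ler_pM2r y0) E => H1.
rewrite -(ler_pM2r y0) [(s * _ + x) * _]mulrDl E => H2.
have ix : 0 < x^-1 by rewrite invr_gt0.
have ix1 : x^-1 <= 1 by rewrite invf_le1.
have E1 : 2 / 3 * (x ^+ 2 - 1) * (P / (4 * x ^+ 2)) = P / 6 - P / 6 * (x^-1) ^+ 2.
  by field; rewrite gt_eqF.
have E2 : x * (P / (4 * x ^+ 2)) = P / 4 * x^-1 by field; rewrite gt_eqF.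
rewrite E1 in H1 H2; rewrite E2 in H2.
have s1 : P * (x^-1) ^+ 2 <= P * x^-1.
  by rewrite ler_pM2l // expr2 ger_pMl.
have s2 : 0 <= P * (x^-1) ^+ 2 by rewrite mulr_ge0 ?ltW // exprn_gt0.
apply/andP; split; last by lra.
have -> : P / 6 * (4 / x) = 4 / 6 * (P * x^-1) by field; rewrite gt_eqF.
have s3 : 0 <= P * x^-1 by rewrite mulr_ge0 ?ltW.
lra.
Qed.

Lemma inv_squares_sum_le n : S n <= pi ^+ 2 / 6.
Proof.
have /andP[_] := inv_squares_sum_bounds n; apply: le_trans.
by apply: le_inv_squares_sum; have := ltn_expl n (isT : (1 < 2)%N); lia.
Qed.

Lemma inv_squares_sum_cvg : S @ \oo --> (pi ^+ 2 / 6 : R).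
Proof.
have pi0 : 0 < pi ^+ 2 :> R by rewrite exprn_gt0 // pi_gt0.
apply/cvgrPdist_le => /= e e0.
have [n _ hn] : \forall n \near \oo, pi ^+ 2 / e <= 2 ^+ n :> R.
  near=> n; apply: (@le_trans _ _ n%:R); last first.
    by rewrite -natrX ler_nat ltnW // ltn_expl.
  by near: n; exact: nbhs_infty_ger.
exists (2 ^ n).-1 => // N /= nN.
have /andP[low _] := inv_squares_sum_bounds n.
have up := inv_squares_sum_le N.
have mono := @le_inv_squares_sum R _ _ nN.
rewrite ger0_norm ?subr_ge0 //.
have : pi ^+ 2 / 2 ^+ n <= e.
  have {}hn := hn n (leqnn n).
  by rewrite ler_pdivrMr ?exprn_gt0 // mulrC -ler_pdivrMr.
have : 0 <= pi ^+ 2 / 2 ^+ n :> R by rewrite divr_ge0 ?ltW // exprn_gt0.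
lra.
Unshelve. all: by end_near. Qed.

Lemma harmonic_average_cvg (u : nat -> R) (B C : R) mu :
    (forall n, `|u n| <= B) ->
    (forall p, (mu < p)%N ->
       harmonic_number R p * u p = \sum_(q < p) u q / (p - q)%:R) ->
    (forall p, (mu <= p)%N -> smoothing p u = C) ->
  u @ \oo --> C / (pi ^+ 2 / 6).
Proof.
have L0 : 0 < pi ^+ 2 / 6 :> R by rewrite divr_gt0 // exprn_gt0 // pi_gt0.
have upper (v : nat -> R) (D : R) : (forall n, `|v n| <= B) ->
    (forall p, (mu < p)%N ->
       harmonic_number R p * v p = \sum_(q < p) v q / (p - q)%:R) ->
    (forall p, (mu <= p)%N -> smoothing p v = D) ->
    forall e, 0 < e -> \forall N \near \oo, v N <= D / (pi ^+ 2 / 6) + e.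
  move=> vB vH vD e e0.
  (* One half of [e] pays for the tilt, the other for replacing S_n by pi^2/6. *)
  have e20 : 0 < e / 2 by rewrite divr_gt0.
  have cD : (fun n => D / S n) @ \oo --> D / (pi ^+ 2 / 6).
    apply: cvgM; first exact: cvg_cst.
    by apply: cvgV; [rewrite gt_eqF | exact: inv_squares_sum_cvg].
  have [k _ hk] : \forall n \near \oo, `|D / (pi ^+ 2 / 6) - D / S n| <= e / 2.
    by move/cvgrPdist_le: cD; exact.
  have := harmonic_average_upper k.+1 vB e20 vH vD.
  apply: filterS => N [n kn].
  have Sn : 0 < S n.
    apply: lt_le_trans (le_inv_squares_sum R (_ : (1 <= n)%N)); last by lia.
    by rewrite /S big_ord1 expr1n invr1.
  rewrite -ler_pdivlMr // mulrDl mulfK ?gt_eqF // => vN.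
  have := hk n (ltnW kn); rewrite ler_norml => /andP[H _].
  lra.
move=> uB uH uC; apply/cvgrPdist_le => /= e e0.
have H1 := upper u C uB uH uC e e0.
have H2 : \forall N \near \oo, - u N <= - C / (pi ^+ 2 / 6) + e.
  apply: (upper (fun n => - u n)) => //.
  - by move=> n; rewrite normrN.
  - by move=> p /uH E; rewrite mulrN E -sumrN; apply: eq_bigr => q _; rewrite mulNr.
  - move=> p /uC <-; rewrite /smoothing -sumrN.
    by apply: eq_bigr => q _; rewrite mulNr.
near=> N.
have N1 : u N <= C / (pi ^+ 2 / 6) + e by near: N.
have N2 : - u N <= - C / (pi ^+ 2 / 6) + e by near: N.
rewrite mulNr in N2.
by rewrite ler_norml; apply/andP; split; lra.
Unshelve. all: by end_near. Qed.

End Basel.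

(** * Full binary trees and the critical beta-splitting law *)

Section Trees.
Local Open Scope nat_scope.
Implicit Types (t T l r : fbtree).

Lemma eq_Node l r l' r' : (Node l r == Node l' r') = (l == l') && (r == r').
Proof. by apply/eqP/andP => [[-> ->]|[/eqP -> /eqP ->]]. Qed.

Lemma nleaves_Node l r : nleaves (Node l r) = nleaves l + nleaves r.
Proof.
by rewrite /nleaves /leaves /= filter_cat !filter_map size_cat !size_map.
Qed.

Lemma nleaves_gt0 T : 0 < nleaves T.
Proof. by elim: T => // l IHl r IHr; rewrite nleaves_Node addn_gt0 IHl. Qed.

Lemma size_nodes T : size (nodes T) = (nleaves T).*2.-1.
Proof.
elim: T => // l IHl r IHr; rewrite nleaves_Node /= size_cat !size_map IHl IHr.
by have := nleaves_gt0 l; have := nleaves_gt0 r; lia.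
Qed.

Lemma fringe_count_Node t l r :
  fringe_count t (Node l r) =
  (Node l r == t) + (fringe_count t l + fringe_count t r).
Proof. by rewrite /fringe_count /= count_cat !count_map. Qed.

Lemma fringe_count_small t T : nleaves T < nleaves t -> fringe_count t T = 0.
Proof.
elim: T => [|l IHl r IHr]; first by have := nleaves_gt0 t; case: t.
rewrite nleaves_Node fringe_count_Node => lt_t.
rewrite IHl ?IHr; try lia.
by case: eqP lt_t => // <-; rewrite nleaves_Node ltnn.
Qed.

Lemma fringe_count_eq t T : nleaves T = nleaves t -> fringe_count t T = (T == t).
Proof.
case: T => [|l r] eq_t; first by rewrite /fringe_count /= addn0.
rewrite fringe_count_Node !fringe_count_small ?addn0 // -eq_t nleaves_Node.
- by have := nleaves_gt0 l; lia.
- by have := nleaves_gt0 r; lia.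
Qed.

Lemma fringe_count_le t T : fringe_count t T <= 2 * nleaves T.
Proof. by apply: leq_trans (count_size _ _) _; rewrite size_nodes; lia. Qed.

Lemma fringe_count_Leaf T : fringe_count Leaf T = nleaves T.
Proof. by elim: T => // l IHl r IHr; rewrite fringe_count_Node nleaves_Node IHl IHr. Qed.

Definition covered t T u :=
  has (fun w => prefix w u && (fringe T w == t)) (nodes T).

(** The root address is a prefix of every address but does not carry [t], and an address in the
    other subtree differs from [b :: u] at its first step. *)
Lemma covered_Node t l r (b : bool) u : Node l r != t ->
  covered t (Node l r) (b :: u) = covered t (if b then r else l) u.
Proof.
move=> /negPf ne_t; rewrite /covered /= ne_t has_cat !has_map /=.
case: b; last first.
  rewrite -[RHS]orbF; congr (_ || _).
  by apply/negbTE/hasPn => w _.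
rewrite -[RHS]orFb; congr (_ || _).
by apply/negbTE/hasPn => w _.
Qed.

(** Occurrences of [t] cover disjoint sets of leaves. If [T] is [t], the root is the only occurrence
    and covers every leaf; otherwise leaves and occurrences split between the two subtrees. *)
Lemma count_covered t T :
  count (covered t T) (leaves T) = nleaves t * fringe_count t T.
Proof.
elim: T => [|l IHl r IHr].
  rewrite /fringe_count /covered /=; case: eqP => [<-|] //=.
  by rewrite muln0.
case: (eqVneq (Node l r) t) => [<-|ne_t].
  rewrite fringe_count_eq // eqxx muln1; apply/eqP; rewrite -all_count.
  by apply/allP => u _; rewrite /covered /= prefix0s eqxx.
rewrite fringe_count_Node (negPf ne_t) add0n mulnDr -IHl -IHr /leaves /=.
rewrite filter_cat !filter_map count_cat !count_map; congr (_ + _);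
  by apply: eq_count => u; rewrite /= covered_Node.
Qed.

End Trees.

(* [k] is fuel; the result is meaningful only for [n <= k]. *)
Fixpoint trees_rec (k n : nat) : seq fbtree :=
  if k is k'.+1 then
    if n == 1%N then [:: Leaf] else
    flatten [seq [seq Node l r | l <- trees_rec k' i, r <- trees_rec k' (n - i)]
            | i <- index_iota 1 n]
  else [::].

Definition trees n := trees_rec n n.

Lemma trees_recS k n : trees_rec k.+1 n =
  if n == 1%N then [:: Leaf] else
  flatten [seq [seq Node l r | l <- trees_rec k i, r <- trees_rec k (n - i)]
          | i <- index_iota 1 n].
Proof. by []. Qed.

Lemma trees_recE k n : (n <= k)%N -> trees_rec k n = trees n.
Proof.
suff E k' : (n <= k)%N -> (n <= k')%N -> trees_rec k n = trees_rec k' n.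
  by move=> nk; apply: E.
elim: k k' n => [|k IH] [|k'] n //=.
- by rewrite leqn0 => /eqP ->.
- by move=> _; rewrite leqn0 => /eqP ->.
move=> nk nk'; case: eqP => // _; congr (flatten _); apply/eq_in_map => i.
rewrite mem_index_iota => /andP[i0 ilt].
by rewrite (IH k' i) ?(IH k' (n - i)%N) //; lia.
Qed.

Lemma treesE n : (1 < n)%N ->
  trees n = flatten [seq [seq Node l r | l <- trees i, r <- trees (n - i)]
                    | i <- index_iota 1 n].
Proof.
move=> n1; rewrite {1}/trees; case: n n1 => // n n1.
rewrite trees_recS gtn_eqF //; congr (flatten _); apply/eq_in_map => i.
rewrite mem_index_iota => /andP[i0 ilt].
by rewrite !trees_recE //; lia.
Qed.

Lemma mem_trees n T : (T \in trees n) = (nleaves T == n).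
Proof.
have n0 : (0 < nleaves T)%N := nleaves_gt0 T.
elim: T n n0 => [|l IHl r IHr] n n0.
  case: n => [|[|n]] //; rewrite treesE //; apply/negbTE/negP.
  by move=> /flatten_mapP[i _ /allpairsP[[l r] [_ _]]].
have l0 := nleaves_gt0 l; have r0 := nleaves_gt0 r.
rewrite nleaves_Node; case: (leqP n 1) => [n1|n1].
  have -> : (nleaves l + nleaves r == n)%N = false by lia.
  by case: n n1 => [|[|n]].
rewrite treesE //; apply/flatten_mapP/eqP => [[i]|<-].
  rewrite mem_index_iota => /andP[i0 ilt] /allpairsP[[l' r'] /= [lt rt [El Er]]].
  by subst l' r'; move: lt rt; rewrite IHl // IHr // => /eqP -> /eqP ->; lia.
exists (nleaves l); first by rewrite mem_index_iota; lia.
by apply/allpairsP; exists (l, r); rewrite /= IHl // IHr // addKn !eqxx.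
Qed.

(** * Expectations under the critical beta-splitting law *)

Section Expectation.
Variable R : realType.
Implicit Types (n : nat) (t T l r : fbtree) (F G : fbtree -> R).
Local Notation h := (harmonic_number R).
Local Notation p := (critical_beta_prob R).

Lemma split_prob_ge0 n i : (i < n)%N -> 0 <= split_prob R n i.
Proof.
move=> ilt; rewrite /split_prob mulr_ge0 // ?divr_ge0 // ?mulr_ge0 //.
  by rewrite -[0](harmonic_number0 R) le_harmonic_number.
by rewrite subr_ge0 ler_nat ltnW.
Qed.

Lemma critical_beta_prob_ge0 n T : 0 <= p n T.
Proof.
elim: T n => [|l IHl r IHr] n //=.
rewrite big_nat; apply: sumr_ge0 => i /andP[_ ilt].
by rewrite mulr_ge0 ?split_prob_ge0 ?mulr_ge0.
Qed.

Lemma critical_beta_prob_eq0 n T : nleaves T != n -> p n T = 0.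
Proof.
elim: T n => [|l IHl r IHr] n; first by rewrite eq_sym /= => /negPf ->.
rewrite nleaves_Node => ne_n /=; rewrite big_nat big1 // => i /andP[i1 ilt].
have [El|/IHl ->] := eqVneq (nleaves l) i; last by rewrite mul0r mulr0.
by rewrite IHr ?mulr0 //; lia.
Qed.

Lemma critical_beta_prob_Node n i l r : (0 < i < n)%N -> nleaves l = i ->
  p n (Node l r) = split_prob R n i * (p i l * p (n - i)%N r).
Proof.
move=> /andP[i0 ilt] El /=.
rewrite (bigD1_seq i) ?iota_uniq ?mem_index_iota ?i0 //= big1 ?addr0 // => j ji.
by rewrite (critical_beta_prob_eq0 (T := l)) ?mul0r ?mulr0 // El eq_sym.
Qed.

Definition tree_mean n F : R := \sum_(T <- trees n) p n T * F T.

Lemma tree_mean1 F : tree_mean 1 F = F Leaf.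
Proof. by rewrite /tree_mean /trees /= big_seq1 /= mul1r. Qed.

Lemma eq_tree_mean n F G : (forall T, nleaves T = n -> F T = G T) ->
  tree_mean n F = tree_mean n G.
Proof.
move=> FG; apply: eq_big_seq => T; rewrite mem_trees => /eqP nT.
by rewrite FG.
Qed.

Lemma le_tree_mean n F G : (forall T, nleaves T = n -> F T <= G T) ->
  tree_mean n F <= tree_mean n G.
Proof.
move=> FG; rewrite /tree_mean 2!big_seq; apply: ler_sum => T.
by rewrite mem_trees => /eqP nT; rewrite ler_wpM2l ?critical_beta_prob_ge0 ?FG.
Qed.

Lemma tree_meanD n F G :
  tree_mean n (fun T => F T + G T) = tree_mean n F + tree_mean n G.
Proof. by rewrite -big_split; apply: eq_bigr => T _; rewrite mulrDr. Qed.

Lemma tree_meanZ n c F : tree_mean n (fun T => c * F T) = c * tree_mean n F.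
Proof. by rewrite /tree_mean mulr_sumr; apply: eq_bigr => T _; rewrite mulrCA. Qed.

Lemma tree_mean_split n F : (1 < n)%N ->
  tree_mean n F = \sum_(1 <= i < n) split_prob R n i *
    tree_mean i (fun l => tree_mean (n - i) (fun r => F (Node l r))).
Proof.
move=> n1; rewrite /tree_mean treesE // big_flatten big_map !big_nat.
apply: eq_bigr => i i_bd; rewrite big_allpairs_dep mulr_sumr.
apply: eq_big_seq => l; rewrite mem_trees => /eqP nl.
rewrite !mulr_sumr; apply: eq_big_seq => r _.
by rewrite (critical_beta_prob_Node _ i_bd nl) !mulrA.
Qed.

(** The splitting law is symmetric under i -> n-i, so both terms contribute equally and cancel the 2
    in its normalisation. This is the source of the kernel 1/(k-q) acting on the normalised values
    a_{q+1}/(q+1). *)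
Lemma sum_split_prob k (a : nat -> R) : (0 < k)%N ->
  \sum_(1 <= i < k.+1) split_prob R k.+1 i * (a i + a (k.+1 - i)%N) =
  k.+1%:R / h k * \sum_(q < k) a q.+1 / q.+1%:R / (k - q)%:R.
Proof.
move=> k0; have hk := harmonic_number_gt0 R k0.
have -> : \sum_(1 <= i < k.+1) split_prob R k.+1 i * (a i + a (k.+1 - i)%N) =
  2 * \sum_(1 <= i < k.+1) split_prob R k.+1 i * a i.
  under eq_bigr do rewrite mulrDr.
  rewrite big_split /= [X in _ + X]big_nat_rev /= mulr2n mulrDl mul1r.
  congr (_ + _); rewrite !big_nat; apply: eq_bigr => i /andP[i1 ik].
  have -> : (1 + k.+1 - i.+1 = k.+1 - i)%N by lia.
  rewrite subKn; last by lia.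
  congr (_ * _); rewrite /split_prob natrB; last by lia.
  by congr (_ * (1 / _)); ring.
rewrite big_add1 /= big_mkord !mulr_sumr; apply: eq_bigr => -[q /= qk] _.
rewrite /split_prob /= -natrB; last by lia.
rewrite subSS.
have kq : 0 < (k - q)%:R :> R by rewrite ltr0n; lia.
have q0 : 0 < q.+1%:R :> R by [].
move: (a _) (h k) (k.+1%:R : R) ((k - q)%:R : R) (q.+1%:R : R) hk kq q0.
by move=> x y z w v y0 w0 v0; field; rewrite !gt_eqF.
Qed.

(** Taking a_i = i in [sum_split_prob] makes a_i + a_{n-i} constant. *)
Lemma sum_split_prob1 n : (1 < n)%N -> \sum_(1 <= i < n) split_prob R n i = 1.
Proof.
case: n => // k k0; rewrite ltnS in k0.
have := sum_split_prob (fun i => i%:R) k0.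
have hk := harmonic_number_gt0 R k0.
have -> : \sum_(q < k) (q.+1%:R / q.+1%:R / (k - q)%:R) = h k.
  rewrite -harmonic_number_rev; apply: eq_bigr => q _.
  by rewrite divff ?mul1r // pnatr_eq0.
rewrite divfK ?gt_eqF //.
rewrite big_nat (eq_bigr (fun i => split_prob R k.+1 i * k.+1%:R)); last first.
  by move=> i /andP[i1 ik]; rewrite -natrD subnKC // ltnW.
have n0 : (k.+1%:R : R) != 0 by rewrite pnatr_eq0.
by rewrite -big_nat -mulr_suml => /(canRL (mulfK n0)) ->; rewrite divff.
Qed.

Lemma tree_mean_cst n (c : R) : (0 < n)%N -> tree_mean n (fun=> c) = c.
Proof.
elim/ltn_ind: n => n IH n0; case: (leqP n 1) => [n1|n1].
  by rewrite (_ : n = 1)%N ?tree_mean1 //; lia.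
rewrite tree_mean_split // big_nat.
rewrite (eq_bigr (fun i => split_prob R n i * c)).
  by rewrite -big_nat -mulr_suml sum_split_prob1 // mul1r.
move=> i /andP[i1 ilt]; congr (_ * _); rewrite (@eq_tree_mean _ _ (fun=> c)).
  by rewrite IH.
by move=> l _; rewrite IH //; lia.
Qed.

(** Proved through the recursion at the root; it implies that [trees n] lists every tree of positive
    probability exactly once. *)
Lemma tree_mean_pred1 n t : tree_mean n (fun T => (T == t)%:R) = p n t.
Proof.
elim: t n => [|l IHl r IHr] [|[|n]]; rewrite ?tree_mean1 //.
- by rewrite /tree_mean big_nil.
- rewrite tree_mean_split //= big_nat big1 // => i /andP[i0 ilt].
  rewrite (@eq_tree_mean _ _ (fun=> 0)) ?tree_mean_cst ?mulr0 //.
  by rewrite subn_gt0.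
- by rewrite /tree_mean big_nil /= big_geq.
- by rewrite /= big_geq.
rewrite tree_mean_split //=; apply: eq_bigr => i _; congr (_ * _).
rewrite -IHl -IHr mulrC -tree_meanZ; apply: eq_tree_mean => l' _.
rewrite mulrC -tree_meanZ; apply: eq_tree_mean => r' _.
by rewrite eq_Node -mulnb natrM.
Qed.

End Expectation.

(** * First and second moments of fringe counts *)

Section Moments.
Variable R : realType.
Implicit Types (n k q : nat) (t T l r : fbtree) (F G Y : fbtree -> R).
Local Notation h := (harmonic_number R).

(** Conditioning on the size of the left subtree and linearity reduce the claim to [sum_split_prob].
    Trees with [k.+1] leaves are normalised by h_k, hence the index shift. *)
Lemma tree_mean_additive (Y : fbtree -> R) k : (0 < k)%N ->
    (forall l r, (nleaves l + nleaves r = k.+1)%N -> Y (Node l r) = Y l + Y r) ->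
  h k * (tree_mean k.+1 Y / k.+1%:R) =
  \sum_(q < k) (tree_mean q.+1 Y / q.+1%:R) / (k - q)%:R.
Proof.
move=> k0 Yadd; have hk := harmonic_number_gt0 R k0.
rewrite tree_mean_split // big_nat.
rewrite (eq_bigr (fun i => split_prob R k.+1 i *
   (tree_mean i Y + tree_mean (k.+1 - i) Y))); last first.
  move=> i /andP[i1 ik]; congr (_ * _).
  rewrite (@eq_tree_mean _ _ _ (fun l => Y l + tree_mean (k.+1 - i) Y)).
    by rewrite tree_meanD tree_mean_cst.
  move=> l il; rewrite -[X in _ = X + _](@tree_mean_cst R (k.+1 - i)); last by lia.
  by rewrite -tree_meanD; apply: eq_tree_mean => r ir; apply: Yadd; lia.
rewrite -big_nat (sum_split_prob (fun i => tree_mean i Y)) //.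
move: (\sum_(q < k) _) (h k) hk => s x x0.
have : 0 < k.+1%:R :> R by [].
move: (k.+1%:R : R) => y y0; by field; rewrite !gt_eqF.
Qed.

(** The square of Y l + Y r is expanded. The squares, normalised by the squared size, give a
    size-biased kernel; by conditional independence the cross term is a product of means and becomes
    the source. *)
Lemma tree_mean_sqr_additive (Y : fbtree -> R) k : (0 < k)%N ->
    (forall l r, (nleaves l + nleaves r = k.+1)%N -> Y (Node l r) = Y l + Y r) ->
  h k * (tree_mean k.+1 (fun T => Y T ^+ 2) / k.+1%:R ^+ 2) =
  \sum_(q < k) (tree_mean q.+1 (fun T => Y T ^+ 2) / q.+1%:R ^+ 2) *
     (q.+1%:R / (k.+1%:R * (k - q)%:R)) +
  k.+1%:R^-1 * \sum_(q < k) (tree_mean q.+1 Y / q.+1%:R) *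
                            (tree_mean (k - q) Y / (k - q)%:R).
Proof.
move=> k0 Yadd; have hk := harmonic_number_gt0 R k0.
pose s i := tree_mean i (fun T => Y T ^+ 2).
pose e i := tree_mean i Y.
rewrite tree_mean_split // big_nat.
rewrite (eq_bigr (fun i => split_prob R k.+1 i * (s i + s (k.+1 - i)%N) +
   split_prob R k.+1 i * (2 * (e i * e (k.+1 - i)%N)))); last first.
  move=> i /andP[i1 ik]; rewrite -mulrDr; congr (_ * _).
  rewrite (@eq_tree_mean _ _ _ (fun l => Y l ^+ 2 + s (k.+1 - i)%N +
       2 * e (k.+1 - i)%N * Y l)).
    by rewrite !tree_meanD tree_mean_cst // tree_meanZ -/(s i) -/(e i); ring.
  move=> l il; rewrite -[X in _ = X + _ + _](@tree_mean_cst R (k.+1 - i)); last by lia.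
  rewrite -tree_meanD mulrAC -tree_meanZ -tree_meanD.
  by apply: eq_tree_mean => r ir; rewrite Yadd; [ring | lia].
rewrite big_split -!big_nat /= (sum_split_prob s) // mulrDl mulrDr.
have n0 : 0 < k.+1%:R :> R by [].
congr (_ + _).
  rewrite [_ / h k * \sum_(q < k) _]mulr_sumr.
  rewrite [(\sum_(q < k) _) / _]mulr_suml [LHS]mulr_sumr.
  apply: eq_bigr => -[q /= qk] _; rewrite -/(s q.+1).
  have kq : 0 < (k - q)%:R :> R by rewrite ltr0n; lia.
  have q0 : 0 < q.+1%:R :> R by [].
  move: (s _) (h k) (k.+1%:R : R) ((k - q)%:R : R) (q.+1%:R : R) hk n0 kq q0.
  by move=> x y z w v y0 z0 w0 v0; field; rewrite !gt_eqF.
rewrite big_add1 /= big_mkord [(\sum_(q < k) _) / _]mulr_suml.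
rewrite [LHS]mulr_sumr [RHS]mulr_sumr.
apply: eq_bigr => -[q /= qk] _; rewrite subSS -/(e q.+1) -/(e (k - q)%N).
rewrite /split_prob /= -natrB; last by lia.
rewrite subSS.
have kq : 0 < (k - q)%:R :> R by rewrite ltr0n; lia.
have q0 : 0 < q.+1%:R :> R by [].
move: (e _) (e _) (h k) (k.+1%:R : R) ((k - q)%:R : R) (q.+1%:R : R) hk n0 kq q0.
by move=> x1 x2 y z w v y0 z0 w0 v0; field; rewrite !gt_eqF.
Qed.

(** One factor of each product is bounded by [B]; the absolute values of the other have Cesaro means
    tending to 0. *)
Lemma convolution_mean_cvg0 (d : nat -> R) (B : R) : (forall q, `|d q| <= B) ->
    d @ \oo --> 0 ->
  (fun k => k.+1%:R^-1 * \sum_(q < k) d q * d (k - q.+1)%N) @ \oo --> 0.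
Proof.
move=> dB d0.
have d0' : (fun q => `|d q|) @ \oo --> 0 by rewrite -(@normr0 _ R); exact: cvg_norm.
have := cesaro d0'; rewrite /arithmetic_mean => c0.
have Bc0 : (fun k => B * (k.+1%:R^-1 * series (fun q => `|d q|) k.+1)) @ \oo --> 0.
  by rewrite -[X in _ --> X](mulr0 B); apply: cvgM => //; exact: cvg_cst.
apply/cvgr0Pnorm_le => /= e e0.
move/cvgr0Pnorm_le : Bc0 => /(_ e e0); apply: filterS => k.
have B0 : 0 <= B by apply: le_trans (dB 0).
rewrite ger0_norm; last first.
  rewrite mulr_ge0 // mulr_ge0 ?invr_ge0 //.
  by rewrite /series /=; apply: sumr_ge0.
apply: le_trans; rewrite normrM ger0_norm ?invr_ge0 // mulrCA ler_wpM2l ?invr_ge0 //.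
rewrite (le_trans (ler_norm_sum _ _ _)) // /series /= big_mkord big_ord_recr /= mulrDr.
rewrite -[leLHS]addr0 lerD ?mulr_ge0 // mulr_sumr.
by apply: ler_sum => q _; rewrite normrM mulrC ler_wpM2r.
Qed.

(** * Mean and mean square for a tree with at least two leaves *)

Section Variance.
Variable t : fbtree.
Hypothesis t1 : (1 < nleaves t)%N.
Local Notation m := (nleaves t).
Local Notation count_t := (fun T => (fringe_count t T)%:R : R).
Let u q : R := tree_mean q.+1 count_t / q.+1%:R.
Let b : R := extended_fringe_limit R t / m%:R.

Lemma neq_Leaf : t != Leaf.
Proof. by apply/eqP => E; move: t1; rewrite E. Qed.

Lemma fringe_density_small q : (q.+1 < m)%N -> u q = 0.
Proof.
move=> qm; rewrite /u (@eq_tree_mean _ _ _ (fun=> 0)) ?tree_mean_cst ?mul0r //.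
by move=> T Tq; rewrite fringe_count_small // Tq.
Qed.

Lemma fringe_density_eq : u m.-1 = critical_beta_prob R m t / m%:R.
Proof.
rewrite /u prednK ?nleaves_gt0 //; congr (_ / _).
rewrite -tree_mean_pred1; apply: eq_tree_mean => T Tm.
by rewrite fringe_count_eq.
Qed.

Lemma fringe_density_bounds q : 0 <= u q <= 2.
Proof.
rewrite /u ler_pdivrMr // divr_ge0 //=; last first.
  rewrite -[leLHS](@tree_mean_cst R q.+1 0) //.
  by apply: le_tree_mean.
rewrite -[leRHS](@tree_mean_cst R q.+1) //; apply: le_tree_mean => T Tq.
by rewrite -natrM ler_nat -Tq fringe_count_le.
Qed.

Lemma fringe_count_additive l r : (m < nleaves l + nleaves r)%N ->
  fringe_count t (Node l r) = (fringe_count t l + fringe_count t r)%N.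
Proof.
move=> mn; rewrite fringe_count_Node; case: eqP => // E.
by move: mn; rewrite -E nleaves_Node ltnn.
Qed.

Lemma fringe_density_harmonic k : (m.-1 < k)%N ->
  h k * u k = \sum_(q < k) u q / (k - q)%:R.
Proof.
move=> mk; apply: tree_mean_additive; first by lia.
move=> l r lr; rewrite fringe_count_additive ?natrD //; lia.
Qed.

(** At k = m-1 only the last term survives, with weight h_{m-1}/(m-1), because smaller trees contain
    no copy of [t]. Beyond that the increments vanish by the recursion, together with [u 0 = 0]. *)
Lemma fringe_density_smoothing k : (m.-1 <= k)%N ->
  smoothing k u = h m.-1 / m.-1%:R * (critical_beta_prob R m t / m%:R).
Proof.
move=> /subnKC <-; elim: (k - m.-1)%N => [|i IH].
  rewrite addn0 -fringe_density_eq.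
  have [j mj] : exists j, m.-1 = j.+1 by exists m.-2; lia.
  rewrite /smoothing mj big_ord_recr /= big1 ?add0r.
    by rewrite subnn harmonic_number0 subr0 mulrC.
  move=> q _; rewrite fringe_density_small ?mul0r //.
  by have := ltn_ord q; lia.
rewrite addnS -IH; apply/eqP; rewrite -subr_eq0 smoothingS.
rewrite fringe_density_harmonic; last by lia.
rewrite big_ord_recl /= fringe_density_small // mul0r add0r.
by rewrite subrr mulr0.
Qed.

Lemma fringe_density_cvg : u @ \oo --> b.
Proof.
have -> : b = h m.-1 / m.-1%:R * (critical_beta_prob R m t / m%:R) / (pi ^+ 2 / 6).
  rewrite /b /extended_fringe_limit (negPf neq_Leaf).
  have -> : m%:R - 1 = m.-1%:R :> R.
    by rewrite -subn1 natrB ?nleaves_gt0.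
  have m0 : 0 < m%:R :> R by rewrite ltr0n nleaves_gt0.
  have m10 : 0 < m.-1%:R :> R by rewrite ltr0n; lia.
  have pi0 := @pi_gt0 R.
  move: (pi : R) (m%:R : R) (m.-1%:R : R) (h _) pi0 m0 m10 => x y z w x0 y0 z0.
  by field; rewrite !gt_eqF.
apply: (@harmonic_average_cvg _ _ 2 _ m.-1).
- by move=> n; have /andP[u0 u2] := fringe_density_bounds n; rewrite ger0_norm.
- exact: fringe_density_harmonic.
- exact: fringe_density_smoothing.
Qed.

(** Centring at [b] times the number of leaves, rather than at the mean, keeps the functional
    additive at trees with more than m leaves. Its normalised mean [d] tends to 0, hence so does the
    source in the second moment recursion. *)
Lemma fringe_count_variance_cvg0 :
  (fun k => tree_mean k.+1 (fun T => (count_t T / k.+1%:R - b) ^+ 2)) @ \oo --> 0.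
Proof.
pose Y T : R := count_t T - b * (nleaves T)%:R.
pose z k := tree_mean k.+1 (fun T => Y T ^+ 2) / k.+1%:R ^+ 2.
pose d q := tree_mean q.+1 Y / q.+1%:R.
have Ez : (fun k => tree_mean k.+1 (fun T => (count_t T / k.+1%:R - b) ^+ 2)) = z.
  apply/funext => k; rewrite /z mulrC -tree_meanZ; apply: eq_tree_mean => T Tk.
  rewrite /Y Tk -exprVn -exprMn mulrBr [_ * (b * _)]mulrCA mulVf ?pnatr_eq0 //.
  by rewrite mulr1 mulrC.
have Ed q : d q = u q - b.
  rewrite /d (@eq_tree_mean _ _ _ (fun T => count_t T + - b * q.+1%:R)).
    by rewrite tree_meanD tree_mean_cst // mulrDl mulfK ?pnatr_eq0.
  by move=> T Tq; rewrite /Y Tq mulNr.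
have d0 : d @ \oo --> 0.
  have -> : d = (fun q => u q - b) by apply/funext.
  rewrite -(subrr b); apply: cvgB; first exact: fringe_density_cvg.
  exact: cvg_cst.
have dB q : `|d q| <= 2 + `|b|.
  rewrite Ed (le_trans (ler_normB _ _)) // lerD2r.
  by have /andP[u0 u2] := fringe_density_bounds q; rewrite ger0_norm.
(* One constant for two bounds: the first summand bounds [z], the second bounds the sums of inverse
   squares. *)
rewrite Ez; pose B := (2 + `|b|) ^+ 2 + pi ^+ 2 / 6.
have pi0 : 0 <= pi ^+ 2 / 6 :> R by rewrite divr_ge0 // sqr_ge0.
apply: (@damped_average_cvg0 _ z
  (fun k => k.+1%:R^-1 * \sum_(q < k) d q * d (k - q.+1)%N) B m.-1).
- move=> k; rewrite /z divr_ge0 ?sqr_ge0 //=; last first.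
    rewrite -[leLHS](@tree_mean_cst R k.+1 0) //.
    by apply: le_tree_mean => T _; rewrite sqr_ge0.
  rewrite ler_pdivrMr ?exprn_gt0 //.
  apply: (@le_trans _ _ ((2 + `|b|) ^+ 2 * k.+1%:R ^+ 2)); last first.
    by rewrite ler_wpM2r ?sqr_ge0 // lerDl.
  rewrite -[leRHS](@tree_mean_cst R k.+1) //; apply: le_tree_mean => T Tk.
  rewrite -exprMn -[leLHS]real_normK ?num_real // ler_sqr ?nnegrE ?mulr_ge0 ?addr_ge0 //.
  rewrite /Y (le_trans (ler_normB _ _)) // normrM Tk mulrDl !(ger0_norm (ler0n _ _)).
  by rewrite lerD2r -natrM ler_nat -Tk fringe_count_le.
- exact: convolution_mean_cvg0 dB d0.
- by move=> n; rewrite (le_trans (inv_squares_sum_le _ _)) // lerDr sqr_ge0.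
- move=> k mk; rewrite /z tree_mean_sqr_additive; last 2 first.
  + by lia.
  + move=> l r lr; rewrite /Y fringe_count_additive ?nleaves_Node; last by lia.
    by rewrite !natrD; ring.
  congr (_ + _ * _); apply: eq_bigr => q _; congr (_ * _).
  by rewrite /d subnSK.
Qed.

End Variance.

Lemma fringe_density_mse_cvg0 t :
  (fun n => tree_mean n (fun T => ((fringe_count t T)%:R / n%:R -
      extended_fringe_limit R t / (nleaves t)%:R) ^+ 2)) @ \oo --> 0.
Proof.
rewrite -cvg_shiftS; case: (ltnP 1 (nleaves t)) => t1.
  exact: fringe_count_variance_cvg0.
(* In the remaining case the count is the number of leaves and the error is identically 0. *)
have -> : t = Leaf.
  case: t t1 => // l r; rewrite nleaves_Node.
  by have := nleaves_gt0 l; have := nleaves_gt0 r; lia.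
rewrite (_ : (fun _ => _) = cst 0); first exact: cvg_cst.
apply/funext => n; rewrite (@eq_tree_mean _ _ _ (fun=> 0)) ?tree_mean_cst //.
move=> T Tn; rewrite fringe_count_Leaf Tn divff ?pnatr_eq0 //.
by rewrite /extended_fringe_limit eqxx divr1 subrr expr0n.
Qed.

End Moments.

(** * From mean squares to convergence in probability *)

Section Probability.
Variable R : realType.
Local Open Scope ereal_scope.

(** The hypothesis gives the law on singletons only. There are countably many trees, so the event is
    a countable union, over the codes of trees, of sets that are empty or null singletons. *)
Lemma critical_beta_tree_nleaves d (Omega : measurableType d)
    (P : probability Omega R) n (D : {RV P >-> fbtree}) :
  is_critical_beta_tree n D ->
  distribution P D [set T | nleaves T != n] = 0.
Proof.
move=> hD; apply/(measure_negligible _) => //.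
have -> : [set T | nleaves T != n] =
  \bigcup_k [set T | pickle T = k /\ nleaves T != n].
  by apply/seteqP; split => [T Tn|T [k _ []//]]; exists (pickle T).
apply: negligible_bigcup => k.
have [->|] := eqVneq [set T : fbtree | pickle T = k /\ nleaves T != n] set0.
  exact: negligible_set0.
move=> /set0P[T [Tk Tn]]; apply: (negligibleS (A := [set T])).
  by move=> T' [T'k _]; apply: (pcan_inj pickleK); rewrite Tk T'k.
apply/negligibleP => //; apply: etrans (hD T) _.
by rewrite critical_beta_prob_eq0.
Qed.

(** Chebyshev's inequality without integration: outside a null set the tree lies in the finite list
    [trees n], and a union bound applies there, where each bad tree has G >= 1. *)
Lemma critical_beta_tree_chebyshev d (Omega : measurableType d)
    (P : probability Omega R) n (D : {RV P >-> fbtree}) (F : fbtree -> R)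
    (c eps : R) :
  is_critical_beta_tree n D -> (0 < eps)%R ->
  P [set w | (eps < `|F (D w) - c|)%R] <=
    (tree_mean n (fun T => (F T - c) ^+ 2)%R / eps ^+ 2)%:E.
Proof.
move=> hD eps0; pose A := [set T : fbtree | (eps < `|F T - c|)%R].
pose G T := ((F T - c) ^+ 2 / eps ^+ 2)%R.
have G0 T : (0 <= G T)%R by rewrite divr_ge0 ?sqr_ge0.
have G1 T : A T -> (1 <= G T)%R.
  move=> AT; rewrite ler_pdivlMr ?exprn_gt0 // mul1r -[leRHS]real_normK ?num_real //.
  by rewrite ler_sqr ?nnegrE ?(ltW eps0) // ltW.
have p0 T := critical_beta_prob_ge0 R n T.
have union_bound (s : seq fbtree) : distribution P D (A `&` [set` s]) <=
    (\sum_(T <- s) critical_beta_prob R n T * G T)%:E.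
  elim: s => [|T s IH]; first by rewrite set_nil setI0 measure0 big_nil.
  have -> : [set` T :: s] = [set T] `|` [set` s].
    apply/seteqP; split => x /=; rewrite inE; first by case/orP => [/eqP|]; [left|right].
    by case=> [->|->]; rewrite ?eqxx ?orbT.
  rewrite big_cons EFinD setIUr (le_trans (measureU2 _ _ _)) // leeD //.
  have [AT|nAT] := pselect (A T); last first.
    have -> : A `&` [set T] = set0.
      by rewrite -subset0 => x [Ax xT]; apply: nAT; rewrite -xT.
    by rewrite measure0 lee_fin mulr_ge0.
  have -> : A `&` [set T] = [set T] by apply: setIidr => x ->.
  by rewrite [leLHS](hD T : _ = _) lee_fin ler_peMr ?G1 // critical_beta_prob_ge0.
rewrite -[leLHS]/(distribution P D A).
have -> : (tree_mean n (fun T => (F T - c) ^+ 2) / eps ^+ 2)%R =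
    (\sum_(T <- trees n) critical_beta_prob R n T * G T)%R.
  by rewrite /tree_mean mulr_suml; apply: eq_bigr => T _; rewrite /G mulrA.
apply: le_trans (union_bound _).
apply: (@le_trans _ _ (distribution P D
    ((A `&` [set` trees n]) `|` [set T | nleaves T != n]))).
  apply: le_measure; rewrite ?inE // => T AT.
  have [nT|nT] := boolP (nleaves T == n); [left; split|right] => //=.
  by rewrite mem_trees.
rewrite (le_trans (measureU2 _ _ _)) //.
by rewrite [X in _ + X](critical_beta_tree_nleaves hD) adde0.
Qed.

End Probability.

Lemma cvg_in_probability_tree_mean (R : realType) (d : nat -> measure_display)
    (Omega : forall n, measurableType (d n)) (P : forall n, probability (Omega n) R)
    (D : forall n, {RV (P n) >-> fbtree}) (F : nat -> fbtree -> R) (c : R) :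
    (forall n, (0 < n)%N -> is_critical_beta_tree n (D n)) ->
    (fun n => tree_mean n (fun T => (F n T - c) ^+ 2)) @ \oo --> 0 ->
  cvg_in_probability P (fun n w => F n (D n w)) c.
Proof.
move=> hD F0 eps eps0.
have H0 : (fun n =>
    (tree_mean n (fun T => (F n T - c) ^+ 2) / eps ^+ 2)%:E) @ \oo --> 0%E.
  apply: cvg_EFin; first exact: nearW.
  by rewrite -[X in _ --> X](mul0r (eps ^+ 2)^-1); apply: cvgM => //; exact: cvg_cst.
apply: (squeeze_cvge _ (cvg_cst 0%E) H0).
near=> n; rewrite measure_ge0 /=; apply: critical_beta_tree_chebyshev => //.
by apply: hD; near: n; exact: nbhs_infty_gt.
Unshelve. all: by end_near. Qed.

Lemma leaf_fringe_probE (R : realType) (t T : fbtree) :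
  leaf_fringe_prob R t T =
  (nleaves t)%:R * ((fringe_count t T)%:R / (nleaves T)%:R).
Proof.
rewrite /leaf_fringe_prob /uniform_prob -/(nleaves T).
by rewrite mulrA -natrM; congr (_%:R / _); exact: count_covered.
Qed.

Lemma fringe_probE (R : realType) (t T : fbtree) :
  fringe_prob R t T = (fringe_count t T)%:R / (nleaves T).*2.-1%:R.
Proof. by rewrite -size_nodes. Qed.

(** The factor 1/2 reflects the 2n-1 nodes of a full binary tree with n leaves. *)
Lemma fringe_limitE (R : realType) (t : fbtree) :
  fringe_limit R t = extended_fringe_limit R t / (nleaves t)%:R / 2.
Proof.
rewrite /fringe_limit /extended_fringe_limit; case: eqP => [->|_].
  by rewrite /nleaves /= divr1.
have m0 : (nleaves t)%:R != 0 :> R by rewrite pnatr_eq0 -lt0n nleaves_gt0.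
rewrite [(_ * (_ - 1))^-1]invfM.
move: (pi ^+ 2)^-1 (_ - 1)^-1 (harmonic_number _ _) (critical_beta_prob _ _ _).
move=> x y z w.
by field.
Qed.

Theorem theorem6p3 (R : realType) (d : nat -> measure_display)
    (Omega : forall n : nat, measurableType (d n))
    (P : forall n : nat, probability (Omega n) R)
    (D : forall n : nat, {RV (P n) >-> fbtree})
    (hD : forall n : nat, (0 < n)%N -> is_critical_beta_tree n (D n))
    (t : fbtree) :
  [/\ cvg_in_probability P (fun n w => fringe_prob R t (D n w))
        (fringe_limit R t),
      cvg_in_probability P (fun n w => leaf_fringe_prob R t (D n w))
        (extended_fringe_limit R t)
    & cvg_in_probability P (fun n w => (fringe_count t (D n w))%:R / n%:R)
        (extended_fringe_limit R t / (nleaves t)%:R)].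
Proof.
have mse := @fringe_density_mse_cvg0 R t.
set b := extended_fringe_limit R t / (nleaves t)%:R in mse *.
have m0 : (nleaves t)%:R != 0 :> R by rewrite pnatr_eq0 -lt0n nleaves_gt0.
split; last exact: (cvg_in_probability_tree_mean
    (F := fun n T => (fringe_count t T)%:R / n%:R)).
- apply: (cvg_in_probability_tree_mean (F := fun _ => fringe_prob R t)) => //.
  rewrite fringe_limitE -/b.
  (* Dominating sequence: the first term comes from the error of N_t/n, the second from replacing
     2n-1 by 2n. *)
  have H0 : (fun n => 2 * tree_mean n (fun T => ((fringe_count t T)%:R / n%:R - b) ^+ 2)
      + 2 * b ^+ 2 * (@harmonic R n) ) @ \oo --> 0.
    rewrite -[X in _ --> X](addr0 0); apply: cvgD.
      by rewrite -[X in _ --> X](mulr0 2); apply: cvgM => //; exact: cvg_cst.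
    rewrite -[X in _ --> X](mulr0 (2 * b ^+ 2)); apply: cvgM; last exact: cvg_harmonic.
    exact: cvg_cst.
  apply: (squeeze_cvgr _ (cvg_cst 0) H0); near=> n.
  have n0 : (0 < n)%N by near: n; exact: nbhs_infty_gt.
  apply/andP; split.
    rewrite -[leLHS](@tree_mean_cst R n 0) //.
    by apply: le_tree_mean => T _; rewrite sqr_ge0.
  rewrite -tree_meanZ -[X in _ + X](@tree_mean_cst R n) // -tree_meanD.
  apply: le_tree_mean => T Tn; rewrite fringe_probE Tn.
  have nR : 1 <= n%:R :> R by rewrite ler1n.
  have -> : n.*2.-1%:R = 2 * n%:R - 1 :> R.
    by rewrite -subn1 natrB ?double_gt0 // -mul2n natrM.
  rewrite /harmonic /= -[n.+1%:R]natr1 -mulrA.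
  move: ((fringe_count t T)%:R : R) (n%:R : R) nR {Tn} => f x x1.
  set y := f / x - b.
  (* The error is v y + w with v <= 1 and w^2 <= b^2/(n+1); then (v y + w)^2 <= 2 (v y)^2 + 2
     w^2. *)
  have -> : f / (2 * x - 1) - b / 2 = x / (2 * x - 1) * y + b / (2 * (2 * x - 1)).
    by rewrite /y; field; apply/andP; split; lra.
  set v := x / _; set w := b / _.
  have a0 : 0 < 2 * x - 1 by lra.
  have v0 : 0 <= v by rewrite divr_ge0 ?ltW //; lra.
  have v1 : v ^+ 2 <= 1.
    by rewrite expr_le1 // /v ler_pdivrMr // mul1r; lra.
  have w1 : w ^+ 2 <= b ^+ 2 / (x + 1).
    have a2 : 0 < (2 * (2 * x - 1)) ^+ 2 by rewrite exprn_gt0 // mulr_gt0.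
    have x10 : 0 < x + 1 by lra.
    have ax : x + 1 <= (2 * (2 * x - 1)) ^+ 2 by nra.
    by rewrite /w exprMn ler_wpM2l ?sqr_ge0 // exprVn lef_pV2 ?posrE.
  have vy : (v * y) ^+ 2 <= y ^+ 2 by rewrite exprMn ler_piMl ?sqr_ge0.
  have -> : (v * y + w) ^+ 2 = 2 * (v * y) ^+ 2 + 2 * w ^+ 2 - (v * y - w) ^+ 2 by ring.
  have := sqr_ge0 (v * y - w); move: (v * y) vy => vy vy1 ?.
  by move: w1; move: (b ^+ 2 / _) => c w1; lra.
- apply: (cvg_in_probability_tree_mean (F := fun _ => leaf_fringe_prob R t)) => //.
  (* On trees with n leaves this ratio is exactly |t|_e N_t/n, so its mean square error is scaled by
     the square of |t|_e. *)
  rewrite -[X in _ --> X](mulr0 ((nleaves t)%:R ^+ 2)).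
  rewrite (_ : (fun _ => _) = (fun n => (nleaves t)%:R ^+ 2 *
    tree_mean n (fun T => ((fringe_count t T)%:R / n%:R - b) ^+ 2))).
    by apply: cvgM => //; exact: cvg_cst.
  apply/funext => n; rewrite -tree_meanZ; apply: eq_tree_mean => T Tn.
  rewrite leaf_fringe_probE Tn -exprMn mulrBr; congr ((_ - _) ^+ 2).
  by rewrite /b mulrC divfK.
Unshelve. all: by end_near. Qed.
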